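(* Let $G$ be a finite connected undirected simple graph with vertex set $V(G)$ and edge set $E(G)$, let $o$ be an alternating orientation of $G$, and let $(G,o)$ be the resulting directed graph. Then \[ \mathrm{rk}\,\mathrm{MH}_{k,l}(G,o)=\mathrm{rk}\,\mathrm{EMH}_{k,l}(G,o)= \begin{cases} |V(G)| & \text{if } (k,l)=(0,0),\\ |E(G)| & \text{if } (k,l)=(1,1),\\ 0 & \text{otherwise.} \end{cases} \] In particular, $(G,o)$ is both diagonal and regularly diagonal.
   Context: $R$ is a fixed nonzero commutative unital ring; rank means rank as a free $R$-module. An orientation $o$ of an undirected graph (a choice of one direction for each edge) is alternating if there is a partition $V\sqcup W$ of the vertices such that all elements of $V$ have indegree $0$ and all elements of $W$ have outdegree $0$. For a directed graph $D$, $d_D(x,y)$ is the minimal length of a directed path from $x$ to $y$ ($\infty$ if none), and $\mathrm{len}(x_0,\dots,x_k)=\sum_{i=0}^{k-1}d_D(x_i,x_{i+1})$ when all terms are finite. $\mathrm{MC}_{k,l}(D)$ is the free $R$-module on tuples $(x_0,\dots,x_k)$ of vertices with $x_i\ne x_{i+1}$ and $d_D(x_i,x_{i+1})<\infty$ for all $i$ and length $l$; $\mathrm{EMC}_{k,l}(D)$ is the submodule spanned by those tuples whose entries are pairwise distinct. The differential on both is $\partial=\sum_{i=1}^{k-1}(-1)^i\partial_i$, where $\partial_i$ deletes $x_i$ if the resulting tuple still has length $l$ and is $0$ otherwise. $\mathrm{MH}_{k,l}(D)=H_k(\mathrm{MC}_{*,l}(D))$ and $\mathrm{EMH}_{k,l}(D)=H_k(\mathrm{EMC}_{*,l}(D))$.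 $D$ is diagonal if $\mathrm{MH}_{k,l}(D)=0$ for all $k\ne l$, and regularly diagonal if $\mathrm{EMH}_{k,l}(D)=0$ for all $k\neq l$. *)

(* Defs.v *)
From HB Require Import structures.
From mathcomp Require Import all_boot all_order all_algebra.
From mathcomp Require Import boolp.

Set Implicit Arguments.
Unset Strict Implicit.
Unset Printing Implicit Defensive.

Import GRing.Theory.
Local Open Scope ring_scope.
Local Open Scope quotient_scope.

(* The homology at [B] of [C --g--> B --f--> A], as a quotient module: the cycles
   modulo those cycles that lie in the image of [g]. When [f \o g = 0] these are
   all of the image. *)
Section Homology.
Variables (R : pzRingType) (C B A : lmodType R).
Variables (g : {linear C -> B}) (f : {linear B -> A}).

Definition cycle_pred : {pred B} := fun x => f x == 0.

Lemma cycle_submod_closed : submod_closed cycle_pred.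
Proof.
split=> [|a x y]; rewrite !unfold_in ?linear0 // => /eqP fx /eqP fy.
by rewrite linearP fx fy scaler0 addr0.
Qed.
HB.instance Definition _ :=
  GRing.isSubmodClosed.Build R B cycle_pred cycle_submod_closed.

Definition cycles := {x : B | x \in cycle_pred}.
HB.instance Definition _ := SubChoice.on cycles.
HB.instance Definition _ := [SubChoice_isSubLmodule of cycles by <:].

Definition boundary_pred : {pred cycles} :=
  fun z => `[< exists c : C, val z = g c >].

Lemma boundary_submod_closed : submod_closed boundary_pred.
Proof.
split=> [|a x y]; rewrite !unfold_in.
  by apply/asboolP; exists 0; rewrite !linear0.
move=> /asboolP[c xc] /asboolP[d yd]; apply/asboolP; exists (a *: c + d).
by rewrite !linearP /= xc yd.
Qed.
HB.instance Definition _ :=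
  GRing.isSubmodClosed.Build R cycles boundary_pred boundary_submod_closed.

Definition homology := Quotient.quot boundary_pred.
HB.instance Definition _ := GRing.Zmodule.on homology.
HB.instance Definition _ := EqQuotient.on homology.

Definition hscale (a : R) (u : homology) : homology :=
  \pi_homology (a *: repr u).

Lemma pi_hscale a (x : cycles) :
  \pi_homology (a *: x) = hscale a (\pi_homology x).
Proof.
apply/eqP; rewrite -[_ == _]Quotient.idealrBE -scalerBr.
rewrite rpredZ // Quotient.idealrBE; apply/eqP; symmetry.
exact: (reprK (\pi_homology x)).
Qed.

Lemma homologyW (P : homology -> Prop) :
  (forall x : cycles, P (\pi_homology x)) -> forall u, P u.
Proof. by move=> Ppi u; rewrite -[u]reprK. Qed.

Lemma hscaleA a b v : hscale a (hscale b v) = hscale (a * b) v.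
Proof. by elim/homologyW: v => x; rewrite -!pi_hscale scalerA. Qed.

Lemma hscale1 : left_id 1 hscale.
Proof. by elim/homologyW=> x; rewrite -!pi_hscale scale1r. Qed.

Lemma hscaleDr : right_distributive hscale +%R.
Proof.
move=> a; elim/homologyW=> x; elim/homologyW=> y.
have piD : {morph \pi_homology : u v / u + v} := Quotient.pi_add boundary_pred.
by rewrite -piD -!pi_hscale scalerDr piD.
Qed.

Lemma hscaleDl v : {morph hscale^~ v : a b / a + b}.
Proof.
have piD : {morph \pi_homology : u v / u + v} := Quotient.pi_add boundary_pred.
by elim/homologyW: v => x a b; rewrite -!pi_hscale scalerDl piD.
Qed.

HB.instance Definition _ :=
  GRing.Zmodule_isLmodule.Build R homology hscaleA hscale1 hscaleDr hscaleDl.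

End Homology.

(* [M] is free of rank [n]; over a nonzero commutative ring [n] is determined by [M]. *)
Definition has_rank (R : comNzRingType) (M : lmodType R) (n : nat) : Prop :=
  inhabited (Vector.axiom n M).

Section Graph.
Variable T : finType.

Definition simple_graph (e : rel T) : Prop := symmetric e /\ irreflexive e.

Definition connected_graph (e : rel T) : Prop := forall x y, connect e x y.

Definition edges (e : rel T) : {set {set T}} :=
  [set [set p.1; p.2] | p : T * T & e p.1 p.2].

Definition orientation (e o : rel T) : Prop :=
  (forall x y, o x y -> e x y) /\ (forall x y, e x y -> o x y (+) o y x).

Definition indegree (o : rel T) (x : T) : nat := #|[set y | o y x]|.
Definition outdegree (o : rel T) (x : T) : nat := #|[set y | o x y]|.

(* The blocks [V] and [W] may be empty: this covers the one-vertex graph. *)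
Definition alternating (o : rel T) : Prop :=
  exists V W : {set T},
    [/\ V :|: W = setT, [disjoint V & W],
        forall x, x \in V -> indegree o x = 0%N
      & forall x, x \in W -> outdegree o x = 0%N].

End Graph.

Section Magnitude.
Variables (T : finType) (o : rel T).

Definition dpath (x y : T) (n : nat) : bool :=
  [exists p : n.-tuple T, path o x p && (last x p == y)].

(* [None] stands for the infinite distance. *)
Definition ddist (x y : T) : option nat :=
  if pselect (exists n, dpath x y n) is left h then Some (ex_minn h) else None.

Definition oadd (m n : option nat) : option nat :=
  if (m, n) is (Some a, Some b) then Some (a + b)%N else None.

Fixpoint len (s : seq T) : option nat :=
  if s is x :: s' then
    if s' is y :: _ then oadd (ddist x y) (len s') else Some 0%N
  else Some 0%N.

Definition mgen (l : nat) (s : seq T) : bool :=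
  sorted (fun x y => x != y) s && (len s == Some l).

Definition mtuple (k l : nat) := {t : k.+1.-tuple T | mgen l t}.
HB.instance Definition _ k l := SubFinite.on (mtuple k l).

Definition mseq k l (t : mtuple k l) : seq T := val (val t).

Definition delete (i : nat) (s : seq T) : seq T := take i s ++ drop i.+1 s.

Variable R : comNzRingType.

Definition MC (k l : nat) := {ffun mtuple k l -> R^o}.
HB.instance Definition _ k l := GRing.Lmodule.on (MC k l).

(* The basis vector of the tuple obtained from [t] by deleting its [i]-th entry,
   or 0 if that tuple is not a generator of length [l]. Consecutive entries of a
   deletion that preserves the length are automatically distinct. *)
Definition face k l (i : nat) (t : mtuple k l) : MC k.-1 l :=
  [ffun u : mtuple k.-1 l => (mseq u == delete i (mseq t))%:R].

(* For [k = 0] this is the zero map, as the inner sum is empty; hence every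
   0-chain is a cycle, as it should be. *)
Definition mdiff k l (c : MC k l) : MC k.-1 l :=
  \sum_(t : mtuple k l) c t *: \sum_(1 <= i < k) (-1) ^+ i *: face i t.

Lemma mdiff_linear k l : linear (@mdiff k l).
Proof.
move=> a c d; rewrite /mdiff scaler_sumr -big_split; apply: eq_bigr => t _ /=.
by rewrite !ffunE scalerDl scalerA.
Qed.
HB.instance Definition _ k l :=
  GRing.isLinear.Build R (MC k l) (MC k.-1 l) _ (@mdiff k l) (@mdiff_linear k l).

(* The span of the tuples with pairwise distinct entries. *)
Definition injective_chain k l : {pred MC k l} :=
  fun c => [forall t, (c t != 0) ==> uniq (mseq t)].

Lemma injective_chain_submod_closed k l : submod_closed (@injective_chain k l).
Proof.
split=> [|a c d]; rewrite !unfold_in.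
  by apply/forallP=> t; rewrite ffunE eqxx.
move=> /forallP ci /forallP di; apply/forallP=> t; apply/implyP; rewrite !ffunE.
apply: contraR => nut.
move: (ci t) (di t); rewrite (negPf nut) !implybF !negbK => /eqP-> /eqP->.
by rewrite scaler0 addr0.
Qed.
HB.instance Definition _ k l := GRing.isSubmodClosed.Build R (MC k l)
  (@injective_chain k l) (@injective_chain_submod_closed k l).

Definition EMC (k l : nat) := {c : MC k l | c \in @injective_chain k l}.
HB.instance Definition _ k l := SubChoice.on (EMC k l).
HB.instance Definition _ k l := [SubChoice_isSubLmodule of EMC k l by <:].

Lemma mdiff_injective_chain k l (c : EMC k l) :
  mdiff (val c) \in @injective_chain k.-1 l.
Proof.
rewrite unfold_in; apply/forallP=> u; apply/implyP; apply: contraR => nuu.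
rewrite /mdiff sum_ffunE; apply/eqP/big1 => t _; rewrite ffunE sum_ffunE.
have [-> | ct] := eqVneq (val c t) 0; first by rewrite scale0r.
have /forallP/(_ t) := valP c; rewrite ct /= => ut.
rewrite big1 ?scaler0 // => i _; rewrite !ffunE.
case: eqP => [uE | _]; last by rewrite scaler0.
case/negP: nuu; rewrite uE; apply: subseq_uniq ut.
rewrite -[X in subseq _ X](cat_take_drop i); apply: cat_subseq => //.
by rewrite -addn1 addnC -drop_drop drop_subseq.
Qed.

Definition emdiff k l (c : EMC k l) : EMC k.-1 l :=
  exist _ (mdiff (val c)) (mdiff_injective_chain c).

Lemma emdiff_linear k l : linear (@emdiff k l).
Proof. by move=> a c d; apply: val_inj; rewrite /= !linearP. Qed.
HB.instance Definition _ k l := GRing.isLinear.Build R (EMC k l) (EMC k.-1 l) _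
  (@emdiff k l) (@emdiff_linear k l).

Definition MH (k l : nat) : lmodType R :=
  homology (@mdiff k.+1 l) (@mdiff k l).

Definition EMH (k l : nat) : lmodType R :=
  homology (@emdiff k.+1 l) (@emdiff k l).

Definition diagonal : Prop := forall k l, k <> l -> forall x : MH k l, x = 0.

Definition regularly_diagonal : Prop :=
  forall k l, k <> l -> forall x : EMH k l, x = 0.

End Magnitude.

(* Main.v *)
Require Import Defs.
From HB Require Import structures.
From mathcomp Require Import all_boot all_order all_algebra.
From mathcomp Require Import boolp.

Set Implicit Arguments.
Unset Strict Implicit.
Unset Printing Implicit Defensive.

(** In an alternating orientation no vertex is both the head and the tail of an
    edge, so directed paths have length at most 1. The only generators of the
    magnitude complex are therefore the vertices, in bidegree (0, 0), and the
    edges, in bidegree (1, 1); these tuples have distinct entries, all the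
    differentials vanish, and homology coincides with the chains. *)

Import GRing.Theory.
Local Open Scope ring_scope.
Local Open Scope quotient_scope.

Lemma has_rank_bij_linear (R : comNzRingType) (M N : lmodType R) (f : M -> N)
    n :
  linear f -> bijective f -> has_rank N n -> has_rank M n.
Proof.
move=> f_lin f_bij [[g g_lin g_bij]]; constructor; exists (g \o f).
  by move=> a x y /=; rewrite f_lin g_lin.
exact: bij_comp.
Qed.

(** Row vectors of width 0 are all equal, and the coordinate map is injective. *)
Lemma has_rank0_eq0 (R : comNzRingType) (M : lmodType R) (x : M) :
  has_rank M 0 -> x = 0.
Proof. by case=> [[f _ /bij_inj f_inj]]; apply: f_inj; apply/rowP => -[]. Qed.

Lemma has_rank_ffun (R : comNzRingType) (I : finType) :
  has_rank {ffun I -> R^o} #|I|.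
Proof.
constructor; exists (fun c : {ffun I -> R^o} => \row_i (c (enum_val i) : R)).
  by move=> a c d; apply/rowP=> i; rewrite !mxE !ffunE.
exists (fun v : 'rV[R]_#|I| => [ffun i => v ord0 (enum_rank i) : R^o]) => [c|v].
  by apply/ffunP=> i; rewrite ffunE mxE enum_rankK.
by apply/rowP=> i; rewrite mxE ffunE enum_valK.
Qed.

Section ZeroDifferentials.
Variables (R : comNzRingType) (C B A : lmodType R).
Variables (g : {linear C -> B}) (f : {linear B -> A}).
Hypotheses (g0 : forall c, g c = 0) (f0 : forall b, f b = 0).

(** As [g] vanishes, 0 is the only boundary, so each homology class contains a single cycle. *)
Lemma pi_homologyK (x : cycles f) : repr (\pi_(homology g f) x) = x.
Proof.
have : \pi_(homology g f) (repr (\pi_(homology g f) x)) = \pi_(homology g f) x.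
  exact: reprK.
move/eqP; rewrite -[_ == _]Quotient.idealrBE => /asboolP[c].
by rewrite g0 => /eqP; rewrite raddfB subr_eq0 => /eqP/val_inj.
Qed.

(** [repr] is only a choice of representatives, but classes are singletons here, so it is linear. As
    [f] vanishes, every chain is a cycle, which supplies the inverse. *)
Lemma has_rank_homology0 n : has_rank B n -> has_rank (homology g f) n.
Proof.
have f0P b : b \in cycle_pred f by rewrite unfold_in f0.
apply: (has_rank_bij_linear (f := fun u : homology g f => val (repr u) : B)).
  move=> a; elim/homologyW=> x; elim/homologyW=> y.
  have piD : {morph \pi_(homology g f) : u v / u + v}.
    exact: Quotient.pi_add.
  rewrite -[a *: \pi_(homology g f) x]pi_hscale -piD !pi_homologyK.
  by rewrite linearP.
exists (fun b => \pi_(homology g f) (exist _ b (f0P b) : cycles f)) => [u|b].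
  by rewrite -[RHS]reprK; congr (\pi _); apply: val_inj.
by rewrite pi_homologyK.
Qed.

End ZeroDifferentials.

Section TwoStepFree.
Variables (T : finType) (o : rel T).
(** The form in which alternation enters: no two edges compose. With [x = y = z] this also excludes
    loops. *)
Hypothesis o2 : forall x y z, o x y -> o y z = false.

Lemma dpath_two_step_free x y n :
  dpath o x y n =
  match n with 0%N => x == y | 1%N => o x y | _ => false end.
Proof.
rewrite /dpath; apply/existsP/idP => [[[s /= /eqP <-]]|].
  case: s => [|a [|b s]] //=; first by rewrite andbT => /andP[? /eqP<-].
  by case/andP=> /and3P[/o2->].
case: n => [xy|[oxy|//]]; first by exists [tuple].
by exists [tuple y] => /=; rewrite oxy eqxx.
Qed.

Lemma ddist_two_step_free x y :
  ddist o x y = if x == y then Some 0%N else if o x y then Some 1%N else None.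
Proof.
rewrite /ddist; case: pselect => [h|noh].
  case: ex_minnP => -[|[|m]]; rewrite dpath_two_step_free //.
    by move=> ->.
  move=> oxy min1; rewrite oxy; case: eqP => // xy.
  (* If [x = y], the empty path would be shorter than the minimum 1. *)
  by have := min1 0%N; rewrite dpath_two_step_free xy eqxx => /(_ isT).
case: eqP => [xy|_].
  by case: noh; exists 0%N; rewrite dpath_two_step_free xy eqxx.
case: ifP => // oxy.
by case: noh; exists 1%N; rewrite dpath_two_step_free.
Qed.

Lemma mgen_two_step_free l s :
  mgen o l s =
  match s with
  | [::] | [:: _] => l == 0%N
  | [:: x; y] => o x y && (l == 1%N)
  | _ => false
  end.
Proof.
have oxx x : o x x = false by apply/negP=> oxx; move: (o2 x oxx); rewrite oxx.
have Some_eq (a b : nat) : (Some a == Some b) = (b == a) by rewrite eq_sym.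
case: s => [|x [|y [|z s]]]; rewrite /mgen /= ?ddist_two_step_free ?Some_eq //.
  case: eqP => [->|_]; first by rewrite oxx.
  by case: (o x y) => //=; rewrite /oadd addn0 Some_eq.
case: eqP => //= _; case: eqP => //= _.
(* With three entries, a finite distance from [x] to [y] forces an edge into [y]; then no edge
   leaves [y], and [z] is at infinite distance. *)
case oxy: (o x y); last by rewrite /oadd andbF.
by rewrite (o2 _ oxy) /oadd andbF.
Qed.

(** The bound on [k] kills the differentials; distinctness of entries makes [EMC] all of [MC]. *)
Lemma mtuple_two_step_free k l (t : mtuple o k l) :
  (k < 2)%N /\ uniq (mseq t).
Proof.
case: t => [[s sk] gen_s]; rewrite /mseq /=.
move: gen_s; rewrite mgen_two_step_free /=; move: (eqP sk).
case: s {sk} => [|x [|y [|z s]]] //= [<-] // /andP[oxy _]; split=> //.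
rewrite inE andbT; apply/eqP=> xy; move: oxy; rewrite xy => oyy.
by move: (o2 y oyy); rewrite oyy.
Qed.

Lemma card_mtuple_two_step_free k l :
  #|{: mtuple o k l}| =
  if (k, l) == (0, 0)%N then #|T|
  else if (k, l) == (1, 1)%N then #|[set p : T * T | o p.1 p.2]| else 0%N.
Proof.
have [[-> ->] | kl0] := eqVneq (k, l) (0, 0)%N.
  have vP x : mgen o 0 [tuple x] by rewrite mgen_two_step_free.
  pose h x : mtuple o 0 0 := exist _ [tuple x] (vP x).
  apply/esym/(bij_eq_card (f := h)).
  exists (fun t => thead (val t)) => [x|t]; first by [].
  by apply/val_inj/val_inj; case: t => -[[|x [|]]].
have [[-> ->] | kl1] := eqVneq (k, l) (1, 1)%N.
  rewrite card_sig -!sum1_card.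
  pose h (p : T * T) := [tuple p.1; p.2].
  pose h' (t : 2.-tuple T) := (tnth t ord0, tnth t ord_max).
  rewrite (reindex h) /=; last first.
    exists h' => [[x y] _ //|t _].
    by apply: val_inj; case: t => [[|a [|b []]]].
  by apply: eq_bigl => p; rewrite !inE mgen_two_step_free /= andbT.
(* A single entry forces [l = 0] and two entries force [l = 1], so no other bidegree has
   generators. *)
apply: eq_card0 => -[[s sk] gen_s]; suff: False by [].
move: gen_s; rewrite mgen_two_step_free /=; move: (eqP sk).
case: s {sk} => [|x [|y [|z s]]] //= [kE].
  by move/eqP=> l0; rewrite -kE l0 in kl0.
by case/andP=> _ /eqP l1; rewrite -kE l1 in kl1.
Qed.

Variable R : comNzRingType.

Lemma mdiff_two_step_free k l (c : MC o R k l) : mdiff c = 0.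
Proof.
(* The existence of [t] gives [k < 2], so there is no interior entry to delete. *)
apply: big1 => t _; rewrite big_geq ?scaler0 //.
by have [] := mtuple_two_step_free t.
Qed.

Lemma has_rank_MC k l : has_rank (MC o R k l) #|{: mtuple o k l}|.
Proof. exact: has_rank_ffun. Qed.

Lemma has_rank_EMC_two_step_free k l :
  has_rank (EMC o R k l) #|{: mtuple o k l}|.
Proof.
have injP (c : MC o R k l) : c \in @injective_chain T o R k l.
  rewrite unfold_in; apply/forallP=> t; apply/implyP=> _.
  by have [] := mtuple_two_step_free t.
apply: (has_rank_bij_linear (f := fun c : EMC o R k l => val c : MC o R k l)).
- by move=> a c d; rewrite linearP.
- exists (fun c => exist _ c (injP c) : EMC o R k l) => // c.
  exact: val_inj.
exact: has_rank_MC.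
Qed.

Lemma has_rank_MH_two_step_free k l :
  has_rank (MH o R k l) #|{: mtuple o k l}|.
Proof.
apply: has_rank_homology0 => [c|c|]; [exact: mdiff_two_step_free..|].
exact: has_rank_MC.
Qed.

Lemma has_rank_EMH_two_step_free k l :
  has_rank (EMH o R k l) #|{: mtuple o k l}|.
Proof.
apply: has_rank_homology0 => [c|c|]; last exact: has_rank_EMC_two_step_free.
all: by apply: val_inj; apply: mdiff_two_step_free.
Qed.

End TwoStepFree.

(** The middle vertex [y] lies in [V], contradicting the edge from [x], or in [W], contradicting the
    edge to [z]. *)
Lemma alternating_two_step_free (T : finType) (o : rel T) x y z :
  alternating o -> o x y -> o y z = false.
Proof.
case=> V [W [VW _ inV outW]] oxy; apply/negP=> oyz.
have := in_setT y; rewrite -VW inE => /orP[/inV|/outW] /eqP.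
  by rewrite cards_eq0 => /eqP/setP/(_ x); rewrite !inE oxy.
by rewrite cards_eq0 => /eqP/setP/(_ z); rewrite !inE oyz.
Qed.

(** Forgetting directions maps arcs onto edges, and injectively, since [o] contains exactly one
    direction of each edge. *)
Lemma card_edges_orientation (T : finType) (e o : rel T) :
  orientation e o -> #|edges e| = #|[set p : T * T | o p.1 p.2]|.
Proof.
move=> [oe eo].
have -> : edges e = [set [set p.1; p.2] | p in [set p : T * T | o p.1 p.2]].
  apply/setP=> A; apply/imsetP/imsetP => -[[x y]]; rewrite inE /= => xy ->.
    have := eo _ _ xy; case oxy: (o x y) => /= oyx.
      by exists (x, y); rewrite ?inE.
    by exists (y, x); rewrite ?inE //= setUC.
  by exists (x, y); rewrite ?inE //= oe.
apply: card_in_imset => -[x y] [a b]; rewrite !inE /= => oxy oab /setP xyab.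
have := eo _ _ (oe _ _ oxy); rewrite oxy /= => oyx.
have := eo _ _ (oe _ _ oab); rewrite oab /= => oba.
have := xyab x; have := xyab y; rewrite !inE !eqxx orbT /=.
(* Besides equal pairs, what remains is a reversed arc or a loop; both contradict the exclusive or
   in [orientation]. *)
move=> /esym/orP[]/eqP yE /esym/orP[]/eqP xE; subst x y => //.
- by rewrite oxy in oyx.
- by rewrite oxy in oba.
- by rewrite oxy in oyx.
Qed.

Local Close Scope ring_scope.

Theorem lemma3p1 (R : comNzRingType) (T : finType) (e o : rel T)
    (simple_e : simple_graph e) (connected_e : connected_graph e)
    (orient_o : orientation e o) (alt_o : alternating o) :
  (forall k l : nat,
     let r := if (k, l) == (0, 0) then #|T|
              else if (k, l) == (1, 1) then #|edges e|
              else 0 in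
     has_rank (MH o R k l) r /\ has_rank (EMH o R k l) r)
  /\ diagonal o R /\ regularly_diagonal o R.
Proof.
have o2 x y z := @alternating_two_step_free T o x y z alt_o.
have card_edges := card_edges_orientation orient_o.
(* Both exceptional bidegrees lie on the diagonal, so off it the rank is 0 and homology vanishes. *)
have mtuple0 k l : k <> l -> #|{: mtuple o k l}| = 0%N.
  move=> kl; rewrite card_mtuple_two_step_free //.
  case: eqP => [[k0 l0]|_]; first by rewrite k0 l0 in kl.
  by case: eqP => [[k1 l1]|//]; rewrite k1 l1 in kl.
split=> [k l r|]; last first.
  split=> k l /mtuple0 kl x; apply: has_rank0_eq0; rewrite -kl.
    exact: has_rank_MH_two_step_free.
  exact: has_rank_EMH_two_step_free.
have -> : r = #|{: mtuple o k l}|.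
  by rewrite card_mtuple_two_step_free // -card_edges.
split; [exact: has_rank_MH_two_step_free|exact: has_rank_EMH_two_step_free].
Qed.
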